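(* Consider $n$ agents on a directed graph $\mathcal{G}=([n],\mathcal{E})$ who update their beliefs by the gossips-without-recall updates, i.e. $\boldsymbol{\mu}_{i,0}(\hat\theta)=\dfrac{\nu(\hat\theta)\,\ell_i(\mathbf{s}_{i,0}\mid\hat\theta)}{\sum_{\tilde\theta\in\Theta}\nu(\tilde\theta)\,\ell_i(\mathbf{s}_{i,0}\mid\tilde\theta)}$ and, for all $t\geq 1$, $i\in[n]$, $\hat\theta\in\Theta$, $$\boldsymbol{\mu}_{i,t}(\hat\theta)=\frac{\boldsymbol{\mu}_{\boldsymbol{\sigma}_{t,i},\,t-1}(\hat\theta)\,\ell_i(\mathbf{s}_{i,t}\mid\hat\theta)}{\sum_{\tilde\theta\in\Theta}\boldsymbol{\mu}_{\boldsymbol{\sigma}_{t,i},\,t-1}(\tilde\theta)\,\ell_i(\mathbf{s}_{i,t}\mid\tilde\theta)},$$ where $\boldsymbol{\sigma}_{t,i}$ is the randomly chosen node whose previous belief agent $i$ uses at time $t$, chosen equal to $j$ with probability $p_{i,j}$. Let $\theta\in\Theta$ be the true state. Suppose that $\mathcal{G}$ is strongly connected and that $\theta$ is globally identifiable, i.e. for every $\check\theta\in\Theta\setminus\{\theta\}$ there is an agent $m\in[n]$ with $D_{KL}\left(\ell_m(\cdot\mid\theta)\,\|\,\ell_m(\cdot\mid\check\theta)\right)>0$. Let $\overline{\pi}=(\pi_1,\dots,\pi_n)$ be the unique probability distribution on $[n]$ with $\overline{\pi}P=\overline{\pi}$, where $P=[p_{i,j}]$. Then all agents learn the truth exponentially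 fast almost surely: conditionally on the true state being $\theta$, with probability one, for every $i\in[n]$ and every $\check\theta\in\Theta\setminus\{\theta\}$, $$\lim_{t\to\infty}\frac1t\log\left(\frac{\boldsymbol{\mu}_{i,t}(\check\theta)}{\boldsymbol{\mu}_{i,t}(\theta)}\right)=-\sum_{m=1}^{n}\pi_m\,D_{KL}\left(\ell_m(\cdot\mid\theta)\,\|\,\ell_m(\cdot\mid\check\theta)\right)<0.$$
   Context: Setting. $n\in\mathbb{N}$, $[n]=\{1,\dots,n\}$, and $\mathcal{G}=([n],\mathcal{E})$ is a directed graph with $\mathcal{E}\subset[n]\times[n]$. The neighborhood of $i$ is $\mathcal{N}(i)=\{j\in[n]:(j,i)\in\mathcal{E}\}$. States and signals. $\Theta$ is a finite set of states and $\nu$ is a probability measure on $\Theta$ with $\nu(\hat\theta)>0$ for all $\hat\theta\in\Theta$ (the common prior). The true state is a $\Theta$-valued random variable $\boldsymbol{\theta}$ with law $\nu$; its realized value is denoted $\theta$. Each agent $i$ has a finite signal space $\mathcal{S}_i$ and, for each $\hat\theta\in\Theta$, a probability mass function $\ell_i(\cdot\mid\hat\theta)$ on $\mathcal{S}_i$. Conditionally on $\boldsymbol{\theta}=\theta$, the random vectors $(\mathbf{s}_{1,t},\dots,\mathbf{s}_{n,t})$, $t=0,1,2,\dots$, are independent over $t$, and for each $i$ the signals $\mathbf{s}_{i,t}$, $t\ge 0$, are i.i.d. with mass function $\ell_i(\cdot\mid\theta)$. For fixed $t$ the signals may be correlated across agents. Random neighbor choices. $(\boldsymbol{\sigma}_{t})_{t\geq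 1}$, $\boldsymbol{\sigma}_t=(\boldsymbol{\sigma}_{t,1},\dots,\boldsymbol{\sigma}_{t,n})$, is an i.i.d. (over $t$) sequence of random vectors, independent of the true state and of all signals, with $\mathbb{P}\{\boldsymbol{\sigma}_{t,i}=j\}=p_{i,j}$, where $P=[p_{i,j}]$ is a row-stochastic $n\times n$ matrix such that $p_{i,j}>0$ for every $j\in\mathcal{N}(i)$ and $p_{i,j}=0$ for every $j\notin\mathcal{N}(i)\cup\{i\}$ (so $p_{i,i}\ge 0$ is allowed). No aperiodicity of $P$ is assumed. When $\mathcal{G}$ is strongly connected, $P$ is irreducible and so has a unique stationary distribution. $\boldsymbol{\mu}_{i,t}$ is the belief of agent $i$ at time $t$, a random probability distribution on $\Theta$. $D_{KL}(p\|q)=\sum_s p(s)\log\frac{p(s)}{q(s)}\in[0,+\infty]$ is the Kullback-Leibler divergence, equal to $+\infty$ if $p(s)>0=q(s)$ for some $s$. Limits are taken in $[-\infty,\infty]$ with the convention $\log 0=-\infty$. *)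

(* Defs.v *)
From HB Require Import structures.
From mathcomp Require Export all_boot all_order all_algebra.
From mathcomp Require Export all_classical all_reals all_analysis.

Set Implicit Arguments.
Unset Strict Implicit.
Unset Printing Implicit Defensive.

Import Order.TTheory GRing.Theory Num.Theory.
Import numFieldNormedType.Exports.

Local Open Scope classical_set_scope.
Local Open Scope ring_scope.

Definition is_pmf (R : realType) (U : finType) (p : U -> R) : Prop :=
  (forall u, 0 <= p u) /\ \sum_u p u = 1.

(* The first test encodes the convention 0 log (0 / q) = 0. *)
Definition KL (R : realType) (U : finType) (p q : U -> R) : \bar R :=
  (\sum_(u : U)
     (if p u == 0%R then 0
      else if q u == 0%R then +oo
      else (p u * ln (p u / q u))%:E))%E.

(* [E j i] means that (j, i) is an edge. *)
Definition neighborhood (n : nat) (E : rel 'I_n) (i : 'I_n) : {set 'I_n} :=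
  [set j | E j i]%SET.

Definition strongly_connected (n : nat) (E : rel 'I_n) : Prop :=
  forall i j : 'I_n, connect E i j.

Definition row_stochastic (R : realType) (n : nat) (P : 'M[R]_n) : Prop :=
  forall i : 'I_n, is_pmf (P i).

Definition gossip_matrix (R : realType) (n : nat) (E : rel 'I_n)
    (P : 'M[R]_n) : Prop :=
  [/\ row_stochastic P,
      forall i j, j \in neighborhood E i -> 0 < P i j &
      forall i j, j \notin neighborhood E i -> j != i -> P i j = 0].

Definition stationary (R : realType) (n : nat) (P : 'M[R]_n)
    (pi : 'rV[R]_n) : Prop :=
  is_pmf (pi 0) /\ pi *m P = pi.

Section Probability.
Context {R : realType} {d : measure_display} {T : measurableType d}.
Implicit Types (Q : set T -> \bar R) (A C : set T).

(* Random variables with values in a finite type carrying its discrete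
   sigma-algebra. *)
Definition finite_rv (U : finType) (X : T -> U) : Prop :=
  forall B : set U, measurable (X @^-1` B).

(* Q is a plain set function in the definitions below so that they apply
   both to a probability and to a conditional probability. *)
Definition cond_prob Q C A : \bar R := (Q (A `&` C) / Q C)%E.

Definition has_law (U : finType) Q (X : T -> U) (p : U -> R) : Prop :=
  forall u, Q (X @^-1` [set u]) = (p u)%:E.

Definition identically_distributed (U : finType) Q (X Y : T -> U) : Prop :=
  forall B : set U, Q (X @^-1` B) = Q (Y @^-1` B).

Definition mutually_independent (U : finType) Q (D : set nat)
    (X : nat -> T -> U) : Prop :=
  forall (J : seq nat) (B : nat -> set U),
    uniq J -> (forall t, t \in J -> D t) ->
    Q (\bigcap_(t in [set` J]) (X t @^-1` B t)) =
    (\prod_(t <- J) Q (X t @^-1` B t))%E.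

Definition events_of (U : finType) (X : T -> U) : set (set T) :=
  [set A | exists B : set U, A = X @^-1` B].

Definition independent_sigma_algebras Q (F G : set (set T)) : Prop :=
  forall A C, F A -> G C -> Q (A `&` C) = (Q A * Q C)%E.

End Probability.

(* A family of signal vectors, possibly correlated across agents at each
   time; only the marginals of each agent are required to be identically
   distributed over time. *)
Definition signal_model (R : realType) (d : measure_display)
    (T : measurableType d) (Pr : probability T R) (n : nat)
    (Theta : finType) (Sig : 'I_n -> finType)
    (ell : forall i : 'I_n, Theta -> Sig i -> R)
    (state : T -> Theta)
    (s : nat -> T -> {dffun forall i : 'I_n, Sig i}) : Prop :=
  (forall t, finite_rv (s t)) /\
  forall th : Theta,
    let Pth := cond_prob Pr (state @^-1` [set th]) in
    mutually_independent Pth setT s /\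
    forall (i : 'I_n) (t : nat),
      has_law Pth (fun w => (s t w i : Sig i)) (ell i th).

(* [sigma t w i] is the node chosen by agent i at time t >= 1; [sigma 0] is
   not constrained and not used. *)
Definition gossip_model (R : realType) (d : measure_display)
    (T : measurableType d) (Pr : probability T R) (n : nat)
    (Theta : finType) (Sig : 'I_n -> finType)
    (P : 'M[R]_n) (state : T -> Theta)
    (s : nat -> T -> {dffun forall i : 'I_n, Sig i})
    (sigma : nat -> T -> {ffun 'I_n -> 'I_n}) : Prop :=
  let times := [set t : nat | (1 <= t)%N] in
  [/\ forall t, times t -> finite_rv (sigma t),
      mutually_independent Pr times sigma,
      forall t t', times t -> times t' ->
        identically_distributed Pr (sigma t) (sigma t'),
      forall t i, times t -> has_law Pr (fun w => sigma t w i) (P i) &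
      independent_sigma_algebras Pr
        <<s \bigcup_(t in times) events_of (sigma t) >>
        <<s events_of state `|` \bigcup_t events_of (s t) >>].

(* Division by zero is 0: this only matters on the null event where a signal
   of zero likelihood under the realized state is observed. *)
Definition bayes (R : realType) (Theta : finType) (prior lik : Theta -> R)
    (th : Theta) : R :=
  prior th * lik th / \sum_(th' : Theta) prior th' * lik th'.

(* Beliefs as a function of the realized signals [x t i] and of the realized
   node choices [c t i]. *)
Fixpoint belief (R : realType) (n : nat) (Theta : finType)
    (Sig : 'I_n -> finType) (nu : Theta -> R)
    (ell : forall i : 'I_n, Theta -> Sig i -> R)
    (x : nat -> {dffun forall i : 'I_n, Sig i})
    (c : nat -> {ffun 'I_n -> 'I_n})
    (t : nat) (i : 'I_n) {struct t} : Theta -> R :=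
  bayes (match t with
         | 0 => nu
         | t'.+1 => belief nu ell x c t' (c t i)
         end)
        (fun th => ell i th (x t i)).

(* Main.v *)
Require Import Defs.
From mathcomp Require Import ring lra.

(** Unrolling the updates, the ratio of the beliefs of [th'] and [th] held by
    agent [i] at time [t] is, up to the prior, the product of the likelihood
    ratios met along the backward path of node choices from [(i, t)]. That path
    changes completely with [t], so no ergodic theorem along a single trajectory
    applies. Instead, its log-likelihood sum [S_(t,i)] satisfies
    [S_(t+1,i) = f_i(s_(t+1,i)) + S_(t,sigma_(t+1,i))] with a first step that is
    independent of the second term. With [h] solving the Poisson equation
    [h - P h = mean f - pi (mean f)], the function [expR (lam * h)] is a Lyapunov
    function for this recursion and gives an exponential tail bound, hence almost
    sure limits by Borel-Cantelli. Applying this to [f] and [- f] settles the case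
    of finite divergences; infinite ones are reached by truncating [f] below.
    Irreducibility enters only through [pi > 0] and the solvability of the Poisson
    equation, so periodicity of [P] is harmless. *)

Set Implicit Arguments.
Unset Strict Implicit.

Import Order.TTheory GRing.Theory Num.Theory.
Import numFieldNormedType.Exports.

Local Open Scope classical_set_scope.
Local Open Scope ring_scope.

(** * Harmonic functions and the Poisson equation *)

Lemma connect_ind_rev (U : finType) (e : rel U) (A : U -> Prop) (x y : U) :
  connect e x y -> (forall u v, e u v -> A v -> A u) -> A y -> A x.
Proof.
move=> /connectP[p + ->] step; elim: p x => [|z p IH] x //= /andP[xz zp] Ap.
by apply: step xz _; exact: IH.
Qed.

Section GossipMatrix.
Context {R : realType} {n : nat} {E : rel 'I_n} {P : 'M[R]_n}.
Hypotheses (E_connected : strongly_connected E) (PE : gossip_matrix E P).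

Lemma gossip_gt0 i j : E j i -> 0 < P i j.
Proof. by case: PE => _ + _ Eji; apply; rewrite inE. Qed.

Lemma gossip_ge0 i j : 0 <= P i j.
Proof. by case: PE => + _ _ => /(_ i)[]. Qed.

Lemma gossip_sum1 i : \sum_j P i j = 1.
Proof. by case: PE => + _ _ => /(_ i)[]. Qed.

(** Stationarity gives [pi 0 j >= pi 0 k * P k j], so positivity passes from [k] to [j] along each
    edge [E j k]; some entry is positive because the entries sum to 1. *)
Lemma stationary_gt0 (pi : 'rV[R]_n) (i : 'I_n) :
  stationary P pi -> 0 < pi 0 i.
Proof.
move=> [[pi_ge0 pi_sum1] piP].
have step j k : E j k -> 0 < pi 0 k -> 0 < pi 0 j.
  move=> Ejk pik; rewrite -piP mxE (bigD1 k) //= ltr_pwDl //.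
    by rewrite mulr_gt0 ?gossip_gt0.
  by apply: sumr_ge0 => l _; rewrite mulr_ge0 ?gossip_ge0.
have [k pik] : exists k, 0 < pi 0 k.
  apply: contrapT => /forallNP pi_le0.
  suff : \sum_k pi 0 k = 0 by move/eqP; rewrite pi_sum1 oner_eq0.
  apply: big1 => k _; apply/eqP; move/negP: (pi_le0 k).
  by rewrite lt_neqAle pi_ge0 andbT negbK eq_sym.
exact: connect_ind_rev (E_connected i k) step pik.
Qed.

(* At a maximum of a harmonic function all the averaged values are maximal. *)
Lemma harmonic_constant (h : 'I_n -> R) :
  (forall i, \sum_j P i j * h j = h i) -> forall i j, h i = h j.
Proof.
move=> harm i j.
pose k := [arg max_(k > i) h k]%O.
have hk l : h l <= h k by rewrite /k; case: arg_maxP => // m _; exact.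
suff hkE l : h l = h k by rewrite !hkE.
apply: (@connect_ind_rev _ E (fun l => h l = h k) l k) => // u v Euv hv.
have : \sum_j P v j * (h k - h j) = 0.
  under eq_bigr do rewrite mulrBr.
  by rewrite sumrB harm -mulr_suml gossip_sum1 mul1r hv subrr.
move=> /psumr_eq0P; move=> /(_ (fun j _ => mulr_ge0 (gossip_ge0 v j) _)).
move=> /(_ (fun j => ltac:(by rewrite subr_ge0)))/(_ u isT)/eqP.
by rewrite mulf_eq0 gt_eqF ?gossip_gt0 //= subr_eq0 => /eqP.
Qed.

(* [1 - P + 1 pi] is the inverse of the fundamental matrix of the chain; unlike
   [1 - P] it is invertible. *)
Lemma poisson_equation (pi : 'rV[R]_n) (g : 'I_n -> R) : stationary P pi ->
  exists h : 'I_n -> R, (forall i, 0 <= h i) /\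
    forall i, g i + \sum_j P i j * h j = \sum_m pi 0 m * g m + h i.
Proof.
move=> [[pi_ge0 pi_sum1] piP].
pose one : 'cV[R]_n := const_mx 1.
have pi1 : pi *m one = 1%:M.
  apply/matrixP => a b; rewrite !ord1 !mxE /= -[RHS]pi_sum1.
  by apply: eq_bigr => k _; rewrite mxE mulr1.
pose Z : 'M[R]_n := 1%:M - P + one *m pi.
have piZ (v : 'cV_n) : pi *m (Z *m v) = pi *m v.
  rewrite mulmxA mulmxDr mulmxBr mulmx1 piP subrr add0r mulmxA pi1 mul1mx //.
have Z1 (v : 'cV_n) i : (Z *m v) i 0 =
    v i 0 - \sum_j P i j * v j 0 + \sum_m pi 0 m * v m 0.
  rewrite mulmxDl mulmxBl mul1mx -mulmxA !mxE; congr (_ + _).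
  by rewrite big_ord1 !mxE mul1r.
(* If [Z v = 0], applying [pi] gives [pi v = 0]; then [v] is harmonic, hence constant, and equal to
   its own [pi]-mean, which is 0. *)
have Z_unit : Z \in unitmx.
  rewrite -unitmx_tr -row_free_unit; apply: inj_row_free => u uZ0.
  have Zv0 : Z *m u^T = 0 by rewrite -[LHS]trmxK trmx_mul trmxK uZ0 trmx0.
  have piv0 : \sum_m pi 0 m * u^T m 0 = 0.
    by have := piZ u^T; rewrite Zv0 mulmx0 => /matrixP/(_ 0 0); rewrite !mxE.
  have uE : forall i j, u^T i 0 = u^T j 0.
    apply: harmonic_constant => i; have := Z1 u^T i.
    by rewrite Zv0 mxE piv0 addr0 => /esym/eqP; rewrite subr_eq0 => /eqP.
  apply/rowP => i; rewrite [RHS]mxE -[u]trmxK mxE -[LHS]mul1r -pi_sum1.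
  rewrite mulr_suml -[RHS]piv0; apply: eq_bigr => m _; congr (_ * _).
  exact: uE.
pose c := \sum_m pi 0 m * g m.
pose v : 'cV[R]_n := \col_i (g i - c).
pose h := invmx Z *m v.
have Zh : Z *m h = v by rewrite mulKVmx.
(* Since [v] has [pi]-mean 0, so does [h]; the rank-one term of [Z] vanishes on [h], leaving
   [h - P h = g - c]. *)
have pih : \sum_m pi 0 m * h m 0 = 0.
  have := piZ h; rewrite Zh => /matrixP/(_ 0 0); rewrite !mxE => <-.
  under eq_bigr do rewrite mxE mulrBr.
  by rewrite sumrB -mulr_suml pi_sum1 mul1r subrr.
(* Rows of [P] sum to 1, so adding the constant [K] preserves the Poisson equation while making the
   solution nonnegative. *)
pose K := \sum_i `|h i 0|.
exists (fun i => h i 0 + K); split=> [i|i].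
  rewrite /K (bigD1 i) //= addrA addr_ge0 ?sumr_ge0 //.
  by rewrite -lerBlDl sub0r -normrN ler_norm.
under eq_bigr do rewrite mulrDr.
rewrite big_split /= -mulr_suml gossip_sum1 mul1r addrA addrA; congr (_ + _).
by have := Z1 h i; rewrite Zh pih addr0 mxE => /eqP;
  rewrite -/c; move=> /eqP; lra.
Qed.
End GossipMatrix.

(** * Exponential moments for a small parameter *)

(** Inverting [1 - y <= expR (- y)] gives [expR y <= (1 - y)^-1]; multiplied out, what remains is
    [0 <= y ^+ 2 * (1 - 2 * y)]. *)
Lemma expR_le_quadratic (R : realType) (y : R) :
  y <= 2^-1 -> expR y <= 1 + y + 2 * y ^+ 2.
Proof.
move=> y_le.
have Ny := expR_ge1Dx (- y).
have Ny_gt0 : 0 < 1 - y by lra.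
have -> : expR y = (expR (- y))^-1 by rewrite expRN invrK.
apply: (@le_trans _ _ (1 - y)^-1).
  by rewrite lef_pV2 ?posrE // (lt_le_trans _ Ny).
rewrite -[leLHS]mul1r ler_pdivrMr // -subr_ge0.
have -> : (1 + y + 2 * y ^+ 2) * (1 - y) - 1 = y ^+ 2 * (1 - 2 * y) by ring.
by apply: mulr_ge0; [exact: sqr_ge0|lra].
Qed.

(** To first order in [lam] each exponential moment is [1 + lam * c]; the second-order term fits in
    the slack [lam * e]. Finiteness of [I] and of each [U i] lets one [lam] serve every [i]. *)
Lemma exponential_tilt (R : realType) (I : finType) (U : I -> finType)
    (p Y : forall i, U i -> R) (c e : R) :
  (forall i, is_pmf (p i)) -> (forall i, \sum_u p i u * Y i u = c) -> 0 < e ->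
  exists2 lam : R, 0 < lam &
    forall i, \sum_u p i u * expR (lam * Y i u) <= expR (lam * (c + e)).
Proof.
move=> p_pmf meanY e_gt0.
pose M := 1 + \sum_i \sum_u `|Y i u|.
have leYM i u : `|Y i u| <= M.
  rewrite /M (bigD1 i) //= (bigD1 u) //=.
  have : 0 <= \sum_(j | j != i) \sum_u `|Y j u|.
    by apply: sumr_ge0 => j _; exact: sumr_ge0.
  have : 0 <= \sum_(v | v != u) `|Y i v| by exact: sumr_ge0.
  lra.
have M_ge1 : 1 <= M.
  by rewrite lerDl; apply: sumr_ge0 => j _; exact: sumr_ge0.
have M_gt0 : 0 < M by lra.
(* The first bound keeps [lam * Y i u] at most 1/2, the range of the quadratic estimate; the second
   bounds the quadratic term by [lam * e]. *)
pose lam := Num.min (2 * M)^-1 (e / (2 * M ^+ 2)).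
have lam_gt0 : 0 < lam.
  by rewrite lt_min invr_gt0 divr_gt0 ?mulr_gt0 ?exprn_gt0.
exists lam => // i; case: (p_pmf i) => p_ge0 p_sum1.
have lamM : lam * M <= 2^-1.
  have : lam <= (2 * M)^-1 by rewrite ge_min lexx.
  move=> /(ler_wpM2r (ltW M_gt0))/le_trans; apply.
  by rewrite invfM -mulrA mulVf ?gt_eqF ?mulr1.
have lamM2 : lam * (2 * M ^+ 2) <= e.
  by rewrite -ler_pdivlMr ?mulr_gt0 ?exprn_gt0 // ge_min lexx orbT.
apply: (@le_trans _ _ (\sum_u p i u * (1 + lam * Y i u + lam * e))).
  apply: ler_sum => u _; apply: ler_wpM2l => //.
  have lamY : lam * Y i u <= 2^-1.
    apply: le_trans lamM; apply: ler_wpM2l; first exact: ltW.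
    by apply: le_trans (leYM i u); exact: ler_norm.
  apply: le_trans (expR_le_quadratic lamY) _; rewrite lerD2l.
  have -> : 2 * (lam * Y i u) ^+ 2 = lam * (lam * (2 * Y i u ^+ 2)) by ring.
  apply: ler_wpM2l; first exact: ltW.
  apply: le_trans lamM2; apply: ler_wpM2l; first exact: ltW.
  apply: ler_wpM2l => //; rewrite -real_normK ?num_real //.
  by rewrite lerXn2r ?nnegrE // ltW.
apply: le_trans _ (expR_ge1Dx _).
under eq_bigr do rewrite mulrDr mulrDr mulr1 mulrCA.
by rewrite !big_split /= -mulr_sumr -mulr_suml p_sum1 meanY mul1r mulrDr addrA.
Qed.

(** * Tail bounds for the score along backward paths *)

Section MeasureGeneral.
Context {R : realType} {d : measure_display} {T : measurableType d}.
Variable mu : {measure set T -> \bar R}.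

Lemma measure_bigsetU_le (I : Type) (r : seq I) (F : I -> set T) :
  (forall i, measurable (F i)) ->
  (mu (\big[setU/set0]_(i <- r) F i) <= \sum_(i <- r) mu (F i))%E.
Proof.
move=> mF; elim: r => [|i r IH]; first by rewrite !big_nil measure0.
rewrite !big_cons; apply: le_trans (measureU2 _ _ _) _ => //.
  exact: bigsetU_measurable.
exact: leeD2l.
Qed.

Lemma measure_le_sum_fibers (U : finType) (X : T -> U) (A : set T) :
  finite_rv X -> measurable A ->
  (mu A <= \sum_(u : U) mu (A `&` X @^-1` [set u]))%E.
Proof.
move=> mX mA.
have mF u : measurable (A `&` X @^-1` [set u]) by exact: measurableI.
apply: le_trans (measure_bigsetU_le _ mF).
apply: le_measure; rewrite ?inE //; first exact: bigsetU_measurable.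
move=> w Aw; rewrite -bigcup_seq; exists (X w) => //=.
exact: mem_index_enum.
Qed.

Lemma measurable_fibers (U : finType) (X : T -> U) (A : set T) :
  (forall u, measurable (A `&` X @^-1` [set u])) -> measurable A.
Proof.
move=> mA.
rewrite (_ : A = \big[setU/set0]_(u : U) (A `&` X @^-1` [set u])).
  exact: bigsetU_measurable.
rewrite -bigcup_seq; apply/seteqP; split=> [w Aw|w [u _ []]] //.
by exists (X w) => //=; exact: mem_index_enum.
Qed.

Lemma finite_rv_pair (U V : finType) (X : T -> U) (Y : T -> V) :
  finite_rv X -> finite_rv Y -> finite_rv (fun w => (X w, Y w)).
Proof.
move=> mX mY B; apply: (measurable_fibers (X := X)) => u.
rewrite (_ : _ `&` _ = Y @^-1` [set v | B (u, v)] `&` X @^-1` [set u]).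
  exact: measurableI.
by apply/seteqP; split=> w /= [+ Xu]; rewrite Xu.
Qed.

(** The first Borel-Cantelli lemma, with summability coming from the geometric series. *)
Lemma geometric_tail_ae (F : nat -> set T) (K q : R) :
  (forall t, measurable (F t)) -> 0 <= K -> 0 <= q -> q < 1 ->
  (forall t, (mu (F t) <= (K * q ^+ t)%:E)%E) ->
  \forall w \ae mu, \forall t \near \oo, ~ F t w.
Proof.
move=> mF K_ge0 q_ge0 q_lt1 le_geo.
have sumF : (\sum_(0 <= t <oo) mu (F t) < +oo)%E.
  apply: (@le_lt_trans _ _ (\sum_(0 <= t <oo) (geometric K q t)%:E)%E).
    by apply: lee_nneseries => t _; rewrite ?measure_ge0 //; exact: le_geo.
  have := @cvg_geometric_series R K q; rewrite ger0_norm // => /(_ q_lt1) geo.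
  under eq_fun do rewrite sumEFin.
  by rewrite (EFin_lim (cvgP _ geo)) ltry.
exists (lim_sup_set F); split; last 1 first.
- move=> w nFw t _; apply: contrapT => nF; apply: nFw => /=.
  exists t => // k tk Fkw; apply: nF; by exists k.
- apply: bigcap_measurable => [|k _]; first by exists 0%N.
  exact: bigcup_measurable.
- exact: lim_sup_set_cvg0.
Qed.
End MeasureGeneral.

Section Score.
Context {R : realType} {n : nat} {Sig : 'I_n -> finType}.
Implicit Types (f : forall i : 'I_n, Sig i -> R).

(* Sum of [f] over the signals met along the backward path of node choices that
   starts at agent [i] at time [t]. *)
Fixpoint score f (x : nat -> {dffun forall i : 'I_n, Sig i})
    (c : nat -> {ffun 'I_n -> 'I_n}) (t : nat) (i : 'I_n) {struct t} : R :=
  f i (x t i) + if t is t'.+1 then score f x c t' (c t i) else 0.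

Lemma scoreN f x c t i :
  score (fun j u => - f j u) x c t i = - score f x c t i.
Proof.
by elim: t i => [|t IH] i /=; rewrite ?addr0 // IH opprD.
Qed.

End Score.

(** * Joint law of signals and node choices given the state *)

Section ConditionalModel.
Context {R : realType} {n : nat} {Theta : finType} {Sig : 'I_n -> finType}.
Context {ell : forall i : 'I_n, Theta -> Sig i -> R} {P : 'M[R]_n}.
Context {d : measure_display} {T : measurableType d} {Pr : probability T R}.
Context {state : T -> Theta} {s : nat -> T -> {dffun forall i : 'I_n, Sig i}}.
Context {sigma : nat -> T -> {ffun 'I_n -> 'I_n}} {p : R} {th : Theta}.
Arguments ell : clear implicits.
Hypotheses (measurable_state : measurable (state @^-1` [set th]))
  (state_law : Pr (state @^-1` [set th]) = p%:E) (p_gt0 : 0 < p)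
  (s_model : signal_model Pr ell state s)
  (sigma_model : gossip_model Pr P state s sigma).

Let Q : set T -> \bar R := cond_prob Pr (state @^-1` [set th]).

(* Unlike [Q], the unnormalized conditional probability is a measure by
   inference. *)
Let mu : {measure set T -> \bar R} := mrestr Pr measurable_state.

Lemma cond_probE A : measurable A -> mu A = (Q A * p%:E)%E.
Proof.
move=> mA; rewrite /Q /cond_prob state_law /mu /= /mrestr.
have : Pr (A `&` state @^-1` [set th]) \is a fin_num.
  by apply: fin_num_measure; exact: measurableI.
move=> /fineK <-; rewrite inver gt_eqF // -!EFinM -mulrA mulVf ?mulr1 //.
by rewrite gt_eqF.
Qed.

(** Signals and choices have separate time lists so that the two constraints of one time can be
    peeled off one after the other. *)
Definition cylinder (Js Jc : seq nat)
    (B : nat -> set {dffun forall i : 'I_n, Sig i})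
    (D : nat -> set {ffun 'I_n -> 'I_n}) : set T :=
  (\bigcap_(t in [set` Js]) (s t @^-1` B t)) `&`
  (\bigcap_(t in [set` Jc]) (sigma t @^-1` D t)).

Lemma measurable_cylinder Js Jc B D : (forall t, t \in Jc -> (1 <= t)%N) ->
  measurable (cylinder Js Jc B D).
Proof.
move=> Jc_gt0; case: s_model sigma_model => s_rv _ [sigma_rv _ _ _ _].
apply: measurableI; apply: fin_bigcap_measurable => //= t tJ.
  exact: s_rv.
by apply: sigma_rv; exact: Jc_gt0.
Qed.

(** Three independences combine: of signals over time given the state, of choices over time, and of
    choices from state and signals together. Hence choices keep the unconditional [Pr]. *)
Lemma cylinder_prob Js Jc B D :
  uniq Js -> uniq Jc -> (forall t, t \in Jc -> (1 <= t)%N) ->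
  mu (cylinder Js Jc B D) =
  ((\prod_(t <- Js) Q (s t @^-1` B t)) *
   (\prod_(t <- Jc) Pr (sigma t @^-1` D t)) * p%:E)%E.
Proof.
move=> Js_uniq Jc_uniq Jc_gt0.
case: s_model => s_rv /(_ th)[s_indep _].
case: sigma_model => sigma_rv sigma_indep _ _ indep.
rewrite -(sigma_indep _ D Jc_uniq Jc_gt0) -(s_indep _ B Js_uniq) //.
set As := \bigcap_(t in [set` Js]) _; set Ac := \bigcap_(t in [set` Jc]) _.
have mAs : measurable As.
  by apply: fin_bigcap_measurable => //= t _; exact: s_rv.
rewrite -/Q muleAC -cond_probE // muleC.
rewrite -[mu _]/(Pr (_ `&` _)) /cylinder -/As -/Ac.
have -> : As `&` Ac `&` state @^-1` [set th] =
    Ac `&` (As `&` state @^-1` [set th]) by rewrite setIA (setIC As).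
apply: indep.
  set G := \bigcup_(t in _) events_of (sigma t).
  apply: (@fin_bigcap_measurable _ (g_sigma_algebraType G)) => // t tJ.
  by apply: sub_sigma_algebra; exists t; [exact: Jc_gt0|exists (D t)].
set G := _ `|` _.
apply: (@measurableI _ (g_sigma_algebraType G)).
  apply: (@fin_bigcap_measurable _ (g_sigma_algebraType G)) => // t tJ.
  by apply: sub_sigma_algebra; right; exists t => //; exists (B t).
by apply: sub_sigma_algebra; left; exists [set th].
Qed.

Lemma cylinder_signal t Js Jc B D A : t \notin Js ->
  cylinder (t :: Js) Jc (fun k => if k == t then A else B k) D =
  s t @^-1` A `&` cylinder Js Jc B D.
Proof.
move=> tJ; rewrite /cylinder setIA; congr (_ `&` _).
rewrite !bigcap_seq big_cons eqxx; congr (_ `&` _).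
by apply: eq_big_seq => k kJ; case: eqP kJ tJ => // -> ->.
Qed.

Lemma cylinder_choice t Js Jc B D C : t \notin Jc ->
  cylinder Js (t :: Jc) B (fun k => if k == t then C else D k) =
  sigma t @^-1` C `&` cylinder Js Jc B D.
Proof.
move=> tJ; rewrite /cylinder setICA; congr (_ `&` _).
rewrite !bigcap_seq big_cons eqxx; congr (_ `&` _).
by apply: eq_big_seq => k kJ; case: eqP kJ tJ => // -> ->.
Qed.

Lemma cylinder_signal_prob t Js Jc B D A :
  t \notin Js -> uniq Js -> uniq Jc -> (forall k, k \in Jc -> (1 <= k)%N) ->
  mu (s t @^-1` A `&` cylinder Js Jc B D) =
  (Q (s t @^-1` A) * mu (cylinder Js Jc B D))%E.
Proof.
move=> tJ Js_uniq Jc_uniq Jc_gt0; rewrite -cylinder_signal //.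
rewrite (cylinder_prob _ _ _ Jc_uniq) ?cons_uniq ?tJ //.
rewrite cylinder_prob // big_cons eqxx !muleA.
congr (_ * _ * _ * _)%E.
by apply: eq_big_seq => k kJ; case: eqP kJ tJ => // -> ->.
Qed.

Lemma cylinder_choice_prob t Js Jc B D C :
  (1 <= t)%N -> t \notin Jc -> uniq Js -> uniq Jc ->
  (forall k, k \in Jc -> (1 <= k)%N) ->
  mu (sigma t @^-1` C `&` cylinder Js Jc B D) =
  (Pr (sigma t @^-1` C) * mu (cylinder Js Jc B D))%E.
Proof.
move=> t_gt0 tJ Js_uniq Jc_uniq Jc_gt0; rewrite -cylinder_choice //.
rewrite (cylinder_prob _ _ Js_uniq) ?cons_uniq ?tJ //; last first.
  by move=> k; rewrite in_cons => /predU1P[->|/Jc_gt0].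
rewrite cylinder_prob // big_cons eqxx muleCA !muleA.
congr (_ * _ * _ * _)%E.
by apply: eq_big_seq => k kJ; case: eqP kJ tJ => // -> ->.
Qed.

(** On each fibre of the latest signal and choice, the score is a shift of a score one time earlier,
    which drives the induction. *)
Lemma measurable_score (f : forall i, Sig i -> R) t i a :
  measurable [set w | a <= score f (s^~ w) (sigma^~ w) t i].
Proof.
have [s_rv _] := s_model; have [sigma_rv _ _ _ _] := sigma_model.
elim: t i a => [|t IH] i a /=.
  exact: s_rv 0%N [set u | a <= f i (u i) + 0].
have sig_rv : finite_rv (fun w => (s t.+1 w i, sigma t.+1 w i)).
  apply: finite_rv_pair.
    by move=> B'; exact: s_rv t.+1 [set u | B' (u i)].
  by move=> B'; exact: sigma_rv t.+1 isT [set u | B' (u i)].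
apply: (measurable_fibers (X := fun w => (s t.+1 w i, sigma t.+1 w i))).
move=> [x j].
rewrite (_ : _ `&` _ = [set w | a - f i x <= score f (s^~ w) (sigma^~ w) t j]
    `&` (fun w => (s t.+1 w i, sigma t.+1 w i)) @^-1` [set (x, j)]).
  by apply: measurableI; [exact: IH|exact: sig_rv].
apply/seteqP; split=> w /= []; rewrite lerBlDl => Sw [Xx Xj].
  by rewrite -Xx -Xj; split.
by rewrite Xx Xj; split.
Qed.

(* The extra factor [cylinder J J B D], an event about times after [t], makes
   the statement inductive: one step of the recursion moves the events of time
   [t] into it. *)
Lemma score_tail (f : forall i, Sig i -> R) (h : 'I_n -> R) (lam c : R) :
  (forall i, \sum_(u : Sig i * 'I_n) ell i th u.1 * P i u.2 *
     expR (lam * (f i u.1 + h u.2 - h i)) <= expR (lam * c)) ->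
  (forall i x, 0 <= ell i th x) -> (forall i j, 0 <= P i j) ->
  (forall i, \sum_j P i j = 1) ->
  (forall i, 0 <= h i) -> 0 < lam ->
  forall t i (a : R) J B D, uniq J -> (forall k, k \in J -> (t < k)%N) ->
  (mu ([set w | (a <= score f (s^~ w) (sigma^~ w) t i)%R]
       `&` cylinder J J B D) <=
   (expR (lam * (c * t.+1%:R + h i - a)))%:E * mu (cylinder J J B D))%E.
Proof.
move=> lyap ell_ge0 P_ge0 P_sum1 h_ge0 lam_gt0.
have [s_rv /(_ th)[_ s_law]] := s_model.
have [sigma_rv _ _ sigma_law _] := sigma_model.
(* Averaging over the first signal and node of the path, with the threshold lowered to
   [a - f i u.1], turns the bound for [k] into the bound for [k + 1]. *)
have key k i a : \sum_(u : Sig i * 'I_n)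
      expR (lam * (c * k + h u.2 - (a - f i u.1))) * (ell i th u.1 * P i u.2)
    <= expR (lam * (c * (k + 1) + h i - a)).
  rewrite (_ : lam * (c * (k + 1) + _ - _) =
    lam * c + lam * (c * k + h i - a)); last by ring.
  rewrite expRD; apply: le_trans (ler_wpM2r (expR_ge0 _) (lyap i)).
  rewrite mulr_suml ler_sum // => u _.
  rewrite -[leRHS]mulrA -expRD [leLHS]mulrC.
  by apply: ler_wpM2l; [exact: mulr_ge0|rewrite ler_expR; lra].
elim=> [|t IH] i a J B D J_uniq tJ; set G := cylinder J J B D.
all: have J_gt0 k : k \in J -> (1 <= k)%N by move=> /tJ; exact: leq_trans.
all: have mG : measurable G by exact: measurable_cylinder.
all: have muG : mu G \is a fin_num by exact: fin_num_measure.
all: have muG_ge0 : 0 <= fine (mu G) by exact: fine_ge0.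
  have X_rv : finite_rv (fun w => s 0 w i).
    by move=> B'; exact: s_rv 0%N [set u | B' (u i)].
  apply: le_trans (measure_le_sum_fibers _ X_rv _) _.
    by apply: measurableI => //; exact: measurable_score.
  apply: (@le_trans _ _ (\sum_(x : Sig i)
      (expR (lam * (f i x - a)))%:E * ((ell i th x)%:E * mu G))%E).
    apply: lee_sum => x _ /=.
    have mux : mu (s 0 @^-1` [set u | u i = x] `&` G) =
        ((ell i th x)%:E * mu G)%E.
      rewrite cylinder_signal_prob //; last by apply/negP => /tJ.
      by rewrite -(s_law i 0%N x).
    (* Markov's inequality signal by signal: the event is empty when the threshold is missed, and
       otherwise the exponential is at least 1. *)
    case: (leP a (f i x)) => [afx|fxa]; last first.
      rewrite (_ : _ `&` _ = set0) ?measure0 ?mule_ge0 ?lee_fin ?expR_ge0 //.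
      apply/seteqP; split=> w //= [[+ _] Xx].
      by rewrite Xx addr0 leNgt fxa.
    rewrite -mux; apply: le_trans (lee_pemull _ _) => //; last first.
      by rewrite lee_fin -expR0 ler_expR mulr_ge0 ?subr_ge0 // ltW.
    apply: le_measure; rewrite ?inE.
    - apply: measurableI; last exact: X_rv.
      by apply: measurableI => //; exact: measurable_score f 0 i a.
    - by apply: measurableI => //; exact: s_rv.
    - by move=> w /= [[_ ?]].
  rewrite -(fineK muG); under eq_bigr do rewrite -!EFinM mulrA.
  rewrite sumEFin lee_fin -mulr_suml; apply: ler_wpM2r => //.
  (* No node is chosen at time 0: [h_ge0] and [P_sum1] let an average of factors [expR (lam * h j)]
     be inserted so that [key] applies. *)
  have := key 0 i a; rewrite add0r mulr0; apply: le_trans.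
  rewrite -(pair_bigA _ (fun x j => expR (lam * (0 + h j - (a - f i x))) *
    (ell i th x * P i j))) /=.
  apply: ler_sum => x _; rewrite -[leLHS]mulr1 -(P_sum1 i) mulr_sumr.
  apply: ler_sum => j _; rewrite mulrA; apply: ler_wpM2r => //.
  apply: ler_wpM2r => //; rewrite ler_expR; apply: ler_wpM2l; first exact: ltW.
  by have := h_ge0 j; lra.
pose X w := (s t.+1 w i, sigma t.+1 w i).
have X_rv : finite_rv X.
  apply: finite_rv_pair.
    by move=> B'; exact: s_rv t.+1 [set u | B' (u i)].
  by move=> B'; exact: sigma_rv t.+1 isT [set u | B' (u i)].
apply: le_trans (measure_le_sum_fibers _ X_rv _) _.
  by apply: measurableI => //; exact: measurable_score.
apply: (@le_trans _ _ (\sum_(u : Sig i * 'I_n)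
    (expR (lam * (c * t.+1%:R + h u.2 - (a - f i u.1))))%:E *
      ((ell i th u.1)%:E * (P i u.2)%:E * mu G))%E).
  apply: lee_sum => -[x j] _; cbn [fst snd].
  have tNJ : t.+1 \notin J by apply/negP => /tJ; rewrite ltnn.
  pose B' k := if k == t.+1 then [set u : {dffun forall i, Sig i} | u i = x]
    else B k.
  pose D' k := if k == t.+1 then [set u : {ffun 'I_n -> 'I_n} | u i = j]
    else D k.
  have J'_gt0 k : k \in t.+1 :: J -> (1 <= k)%N.
    by rewrite in_cons => /predU1P[->|/J_gt0].
  have J'_uniq : uniq (t.+1 :: J) by rewrite /= tNJ.
  (* On this fibre the score reaches [a] exactly when the score from [j] at time [t] reaches
     [a - f i x]. *)
  rewrite (_ : _ `&` _ = [set w | a - f i x <= score f (s^~ w) (sigma^~ w) t j]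
      `&` cylinder (t.+1 :: J) (t.+1 :: J) B' D'); last first.
    rewrite cylinder_signal // cylinder_choice // -/G.
    apply/seteqP; split=> w /=.
      by move=> [[Sw Gw] [Xx Xj]]; rewrite -{1}Xx -Xj lerBlDl; split.
    by move=> [Sw [Xx [Xj Gw]]]; rewrite /X Xx Xj -lerBlDl; split.
  apply: le_trans (IH _ _ _ _ _ J'_uniq _) _.
    by move=> k; rewrite in_cons => /predU1P[->|/tJ/ltnW].
  rewrite cylinder_signal // cylinder_signal_prob // cylinder_choice //.
  rewrite cylinder_choice_prob // -(s_law i t.+1 x) -(sigma_law t.+1 i _ j) //.
  by rewrite !muleA.
rewrite -(fineK muG); under eq_bigr do rewrite -!EFinM mulrA.
rewrite sumEFin lee_fin -mulr_suml; apply: ler_wpM2r => //.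
by rewrite -[t.+2]addn1 natrD; exact: key.
Qed.
(** This excludes the null event on which a Bayes denominator could vanish; it is a countable union
    over times of finite unions over agents and signal values. *)
Lemma signal_likelihood_gt0_ae : (forall i x, 0 <= ell i th x) ->
  \forall w \ae mu, forall t i, 0 < ell i th (s t w i).
Proof.
move=> ell_ge0; have [s_rv /(_ th)[_ s_law]] := s_model.
apply: ae_foralln => t; apply: filter_forall => i.
exists (s t @^-1` [set u | ~~ (0 < ell i th (u i))]); split.
- exact: s_rv.
- apply/eqP; rewrite -measure_le0.
  apply: le_trans (measure_le_sum_fibers _ (X := fun w => s t w i) _ _) _.
  + by move=> B; exact: s_rv t [set u | B (u i)].
  + exact: s_rv.
  rewrite big1 // => x _.
  case: (ltP 0 (ell i th x)) => [ellx|ellx].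
    rewrite (_ : _ `&` _ = set0) ?measure0 //.
    by apply/seteqP; split=> w //= [+ Xx]; rewrite Xx ellx.
  have mux : mu (s t @^-1` [set u | u i = x]) = 0%E.
    rewrite cond_probE; last exact: s_rv.
    rewrite [Q _](s_law i t x) (_ : ell i th x = 0) ?mul0e //.
    by apply/eqP; rewrite eq_le ellx ell_ge0.
  apply/eqP; rewrite -measure_le0 -mux; apply: le_measure; rewrite ?inE.
  + by apply: measurableI; [exact: s_rv|exact: s_rv t [set u | u i = x]].
  + exact: s_rv.
  + by move=> w [].
- by move=> w /=; move/negP.
Qed.

(* Chernoff bound with the Lyapunov function [expR (lam * h)], where [h] solves
   the Poisson equation of the mean of [f]. *)
Lemma score_limsup_ae (E : rel 'I_n) (pi : 'rV[R]_n)
    (f : forall i, Sig i -> R) :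
  strongly_connected E -> gossip_matrix E P -> stationary P pi ->
  (forall i, is_pmf (ell i th)) ->
  \forall w \ae mu, forall k i, \forall t \near \oo,
    score f (s^~ w) (sigma^~ w) t i <
    (\sum_m pi 0 m * (\sum_x ell m th x * f m x) + k.+1%:R^-1) * t.+1%:R.
Proof.
move=> E_connected PE pi_stat ell_pmf.
set c := \sum_m _.
apply: ae_foralln => k; apply: filter_forall => i.
set e : R := k.+1%:R^-1.
have e_gt0 : 0 < e by rewrite invr_gt0.
have [h [h_ge0 h_poisson]] := poisson_equation E_connected PE
  (fun m => \sum_x ell m th x * f m x) pi_stat.
have ell_sum1 j : \sum_x ell j th x = 1 by case: (ell_pmf j).
have ell_ge0 j x : 0 <= ell j th x by case: (ell_pmf j).
have P_sum1 := gossip_sum1 PE; have P_ge0 := gossip_ge0 PE.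
(* By the Poisson equation the corrected increment has mean exactly [c] from every agent. Half of
   [e] is spent here; the other half gives the decay factor [q]. *)
have [||lam lam_gt0 lyap] := @exponential_tilt R 'I_n
  (fun i => (Sig i * 'I_n)%type) (fun i u => ell i th u.1 * P i u.2)
  (fun i u => f i u.1 + h u.2 - h i) c (e / 2) _ _
  (divr_gt0 e_gt0 (ltr0Sn _ _)).
- move=> j; split=> [u|]; first exact: mulr_ge0.
  rewrite -(pair_bigA _ (fun x l => ell j th x * P j l)) /=.
  by under eq_bigr do rewrite -mulr_sumr P_sum1 mulr1.
- move=> j.
  rewrite -(pair_bigA _
    (fun x l => ell j th x * P j l * (f j x + h l - h j))) /=.
  transitivity (\sum_x (ell j th x * f j x
      + ell j th x * (\sum_l P j l * h l - h j))).
    apply: eq_bigr => x _; rewrite mulrBr.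
    rewrite (_ : ell j th x * h j = \sum_l ell j th x * P j l * h j).
      rewrite -[ell j th x * f j x]mulr1 -(P_sum1 j) !mulr_sumr.
      rewrite -sumrB -big_split /=; apply: eq_bigr => l _; ring.
    by rewrite -mulr_suml -mulr_sumr P_sum1 mulr1.
  rewrite big_split /= -mulr_suml ell_sum1 mul1r.
  by rewrite addrA h_poisson addrK.
pose q := expR (- (lam * (e / 2))).
apply: (@filterS _ _ _ (fun w => \forall t \near \oo,
    ~ ((c + e) * t.+1%:R <= score f (s^~ w) (sigma^~ w) t i))).
  move=> w; apply: filterS => t /negP; by rewrite -ltNge.
apply: (@geometric_tail_ae _ _ _ mu (fun t => [set w |
    (c + e) * t.+1%:R <= score f (s^~ w) (sigma^~ w) t i])
  (expR (lam * h i) * q * p) q).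
- by move=> t; exact: measurable_score.
- by rewrite !mulr_ge0 ?expR_ge0 // ltW.
- exact: expR_ge0.
- by rewrite expR_lt1 oppr_lt0 mulr_gt0 // divr_gt0.
move=> t.
have := @score_tail f h lam (c + e / 2) lyap ell_ge0 P_ge0 P_sum1 h_ge0 lam_gt0
  t i ((c + e) * t.+1%:R) [::] (fun=> setT) (fun=> setT) isT _.
rewrite (_ : cylinder _ _ _ _ = setT); last first.
  by rewrite /cylinder !set_nil !bigcap_set0 setIT.
rewrite setIT (_ : mu setT = p%:E); last by rewrite /mu /= /mrestr setTI.
move=> /(_ (fun k => ltac:(by [])))/le_trans; apply.
rewrite -EFinM lee_fin.
rewrite (_ : _ * q * p * _ = expR (lam * h i) * q ^+ t.+1 * p); last first.
  by rewrite exprS; ring.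
apply: ler_wpM2r; first exact: ltW.
rewrite /q -expRM_natl -expRD ler_expR le_eqVlt; apply/orP; left.
by apply/eqP; field.
Qed.
End ConditionalModel.

(** A null set stays null after division by the mass of [C]; this passes from the restricted measure
    to the plain set function [cond_prob]. *)
Lemma ae_cond_prob (R : realType) d (T : measurableType d)
    (Pr : probability T R) (C : set T) (mC : measurable C) (S : T -> Prop) :
  (\forall w \ae mrestr Pr mC, S w) -> \forall w \ae cond_prob Pr C, S w.
Proof.
move=> [A [mA A0 SA]]; exists A; split=> //.
by rewrite /cond_prob; move: A0; rewrite /mrestr => ->; rewrite mul0e.
Qed.

(** * Likelihood ratios *)

Section KullbackLeibler.
Context {R : realType} {U : finType} {p q : U -> R}.
Hypotheses (p_pmf : is_pmf p) (q_pmf : is_pmf q).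

(** Written with [ln (q u / p u)] so that minus the divergence is the mean increment of a
    log-likelihood score. *)
Lemma KL_fin : (forall u, p u != 0 -> q u != 0) ->
  KL p q = (- \sum_u p u * ln (q u / p u))%:E.
Proof.
case: p_pmf q_pmf => p_ge0 _ [q_ge0 _] pq.
rewrite /KL -sumrN -sumEFin; apply: eq_bigr => u _.
case: eqP => [->|/eqP pu]; first by rewrite mul0r oppr0.
rewrite (negPf (pq u pu)) -mulrN -lnV; first by rewrite invf_div.
by rewrite posrE divr_gt0 // lt_def ?pu ?pq ?p_ge0 ?q_ge0.
Qed.

Lemma KL_eqy u : p u != 0 -> q u = 0 -> KL p q = +oo%E.
Proof.
move=> pu qu; apply/esum_eqyP.
  by move=> v _; case: ifP => // _; case: ifP.
by exists u; split; rewrite ?mem_index_enum // (negPf pu) qu eqxx.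
Qed.

(* Gibbs' inequality, from [ln x <= x - 1]. *)
Lemma KL_ge0 : (0 <= KL p q)%E.
Proof.
case: (p_pmf) (q_pmf) => p_ge0 p_sum1 [q_ge0 q_sum1].
have [/forallP pq|] := boolP [forall u, (p u != 0) ==> (q u != 0)]; last first.
  rewrite negb_forall => /existsP[u].
  rewrite negb_imply negbK => /andP[pu /eqP qu].
  by rewrite (KL_eqy pu qu).
rewrite KL_fin => [|u]; last exact/implyP.
rewrite lee_fin oppr_ge0.
apply: (@le_trans _ _ (\sum_u (q u - p u))); last first.
  by rewrite sumrB p_sum1 q_sum1 subrr.
apply: ler_sum => u _.
have [->|pu] := eqVneq (p u) 0; first by rewrite mul0r subr0.
have pu_gt0 : 0 < p u by rewrite lt_def pu p_ge0.
have qu_gt0 : 0 < q u by rewrite lt_def q_ge0 andbT; exact: (implyP (pq u)).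
have -> : q u - p u = p u * (q u / p u - 1) by field.
apply: ler_wpM2l => //.
rewrite -{1}(subrK 1 (q u / p u)) addrC.
by apply: le_ln1Dx; rewrite ltrBrDl subrr divr_gt0.
Qed.
End KullbackLeibler.

Section BeliefRatio.
Context {R : realType} {n : nat} {Theta : finType} {Sig : 'I_n -> finType}.
Variables (nu : Theta -> R) (ell : forall i : 'I_n, Theta -> Sig i -> R).
Arguments ell : clear implicits.
Variables (x : nat -> {dffun forall i : 'I_n, Sig i})
  (c : nat -> {ffun 'I_n -> 'I_n}) (th : Theta).
Hypotheses (nu_gt0 : forall th, 0 < nu th)
  (ell_ge0 : forall i th u, 0 <= ell i th u)
  (x_gt0 : forall t i, 0 < ell i th (x t i)).

Lemma bayes_ge0 (prior lik : Theta -> R) (th' : Theta) :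
  (forall th', 0 <= prior th') -> (forall th', 0 <= lik th') ->
  0 <= bayes prior lik th'.
Proof.
move=> ? ?; rewrite divr_ge0 ?mulr_ge0 // sumr_ge0 // => ? _.
by rewrite mulr_ge0.
Qed.

Lemma bayes_sum_gt0 (prior lik : Theta -> R) :
  (forall th', 0 <= prior th') -> (forall th', 0 <= lik th') ->
  0 < prior th -> 0 < lik th -> 0 < \sum_th' prior th' * lik th'.
Proof.
move=> prior_ge0 lik_ge0 prior_gt0 lik_gt0.
rewrite (bigD1 th) //= ltr_pwDl ?mulr_gt0 // sumr_ge0 // => ? _.
by rewrite mulr_ge0.
Qed.

Lemma bayes_ratio (prior lik : Theta -> R) (th' : Theta) :
  (forall th', 0 <= prior th') -> (forall th', 0 <= lik th') ->
  0 < prior th -> 0 < lik th ->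
  bayes prior lik th' / bayes prior lik th =
  prior th' / prior th * (lik th' / lik th).
Proof.
move=> prior_ge0 lik_ge0 prior_gt0 lik_gt0.
have := bayes_sum_gt0 prior_ge0 lik_ge0 prior_gt0 lik_gt0.
rewrite /bayes; set Z := \sum_(_ : _) _ => Z_gt0.
by field; rewrite !gt_eqF.
Qed.

(** Positivity at [th] survives each update because every observed signal has positive likelihood
    under [th]. *)
Lemma belief_ge0_gt0 t i :
  (forall th', 0 <= belief nu ell x c t i th') /\ 0 < belief nu ell x c t i th.
Proof.
elim: t i => [|t IH] i /=.
  split=> [th'|]; first by apply: bayes_ge0 => // th''; exact: ltW.
  apply: divr_gt0; first exact: mulr_gt0.
  by apply: bayes_sum_gt0 => // th'; exact: ltW.
have [mu_ge0 mu_gt0] := IH (c t.+1 i).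
split=> [th'|]; first exact: bayes_ge0.
apply: divr_gt0; first exact: mulr_gt0.
exact: bayes_sum_gt0.
Qed.

Lemma belief_ratio0 i th' :
  belief nu ell x c 0 i th' / belief nu ell x c 0 i th =
  nu th' / nu th * (ell i th' (x 0 i) / ell i th (x 0 i)).
Proof. by apply: bayes_ratio => // ?; exact: ltW. Qed.

Lemma belief_ratioS t i th' :
  belief nu ell x c t.+1 i th' / belief nu ell x c t.+1 i th =
  belief nu ell x c t (c t.+1 i) th' / belief nu ell x c t (c t.+1 i) th *
  (ell i th' (x t.+1 i) / ell i th (x t.+1 i)).
Proof.
by have [? ?] := belief_ge0_gt0 t (c t.+1 i); apply: bayes_ratio.
Qed.

Lemma belief_ratio_ge0 t i th' :
  0 <= belief nu ell x c t i th' / belief nu ell x c t i th.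
Proof. by have [? ?] := belief_ge0_gt0 t i; rewrite divr_ge0. Qed.

(** The one-sided form accommodates truncation: a zero likelihood ratio lies below every exponential
    but equals none. *)
Lemma belief_ratio_le (f : forall i, Sig i -> R) t i th' :
  (forall i u, 0 < ell i th u -> ell i th' u / ell i th u <= expR (f i u)) ->
  belief nu ell x c t i th' / belief nu ell x c t i th <=
  nu th' / nu th * expR (score f x c t i).
Proof.
move=> ell_le; elim: t i => [|t IH] i.
  rewrite belief_ratio0 /= addr0 ler_wpM2l //; last exact: ell_le.
  by rewrite divr_ge0 // ltW.
rewrite belief_ratioS /= addrC expRD [leRHS]mulrA ler_pM //.
- exact: belief_ratio_ge0.
- by rewrite divr_ge0.
- exact: ell_le.
Qed.

Lemma belief_ratio_eq (f : forall i, Sig i -> R) t i th' :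
  (forall i u, 0 < ell i th u -> ell i th' u / ell i th u = expR (f i u)) ->
  belief nu ell x c t i th' / belief nu ell x c t i th =
  nu th' / nu th * expR (score f x c t i).
Proof.
move=> ell_eq; elim: t i => [|t IH] i.
  by rewrite belief_ratio0 /= addr0 ell_eq.
by rewrite belief_ratioS /= addrC expRD [RHS]mulrA IH ell_eq.
Qed.
End BeliefRatio.

(* Replacing [ln 0] by [- k] and letting [k] grow handles the agents of infinite
   divergence. *)
Definition truncated_llr (R : realType) (n : nat) (Theta : finType)
    (Sig : 'I_n -> finType) (ell : forall i : 'I_n, Theta -> Sig i -> R)
    (th th' : Theta) (k : nat) (i : 'I_n) (u : Sig i) : R :=
  if ell i th' u == 0 then - k%:R else ln (ell i th' u / ell i th u).

(** * Exponential rates from linear bounds *)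

Section Limits.
Context {R : realType}.

Lemma near_linear_lt (S : nat -> R) (c : R) :
  (forall k, \forall t \near \oo, S t < (c + k.+1%:R^-1) * t.+1%:R) ->
  forall e C : R, 0 < e -> \forall t \near \oo, (C + S t) / t%:R <= c + e.
Proof.
move=> S_lt e C e_gt0.
pose k := Num.truncn (2 / e).
have ke : k.+1%:R^-1 <= e / 2.
  rewrite -[e / 2]invrK lef_pV2 ?posrE ?invr_gt0 ?divr_gt0 // invf_div.
  by apply: ltW; exact: truncnS_gt.
near=> t.
have t_gt0 : 0 < t%:R :> R by rewrite ltr0n; near: t; exact: nbhs_infty_gt.
rewrite ler_pdivrMr //.
have : S t < (c + k.+1%:R^-1) * t.+1%:R by near: t; exact: S_lt.
have : (c + k.+1%:R^-1) * t.+1%:R <= (c + e / 2) * t.+1%:R.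
  by apply: ler_wpM2r => //; rewrite lerD2l.
(* The offset [C] and the shift from [t] to [t.+1] contribute the constant [C + c + e / 2], absorbed
   by the spare [e / 2 * t%:R] for large [t]. *)
have : (2 / e) * (C + c + e / 2) <= t%:R.
  by near: t; exact: nbhs_infty_ger.
rewrite -ler_pdivlMl ?divr_gt0 // invf_div -[t.+1]addn1 natrD.
move=> C_le kt_le St_lt; rewrite -subr_ge0.
rewrite (_ : _ - _ = (e / 2 * t%:R - (C + c + e / 2)) +
  ((c + e / 2) * (t%:R + 1) - S t)); last by field.
by rewrite addr_ge0 ?subr_ge0 // (le_trans (ltW St_lt)).
Unshelve. all: by end_near.
Qed.

(** Upper linear bounds on [S] and on [- S] squeeze [S t / t], while [ln C / t] tends to 0. *)
Lemma cvg_rate_fin (S : nat -> R) (c C : R) (y : nat -> R) :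
  (forall k, \forall t \near \oo, S t < (c + k.+1%:R^-1) * t.+1%:R) ->
  (forall k, \forall t \near \oo, - S t < (- c + k.+1%:R^-1) * t.+1%:R) ->
  0 < C -> (forall t, y t = C * expR (S t)) ->
  (fun t : nat => ((t%:R^-1)%:E * lne (y t)%:E)%E) @ \oo --> c%:E.
Proof.
move=> S_lt S_gt C_gt0 yE.
have -> : (fun t : nat => ((t%:R^-1)%:E * lne (y t)%:E)%E) =
    (fun t : nat => ((ln C + S t) / t%:R)%:E).
  apply/funext => t.
  by rewrite yE lne_EFin ?mulr_gt0 ?expR_gt0 // lnM ?posrE ?expR_gt0 // expRK
    -EFinM mulrC.
apply: cvg_EFin; first exact: nearW.
apply/cvgrPdist_le => e e_gt0; near=> t.
have : (ln C + S t) / t%:R <= c + e by near: t; exact: near_linear_lt.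
have : (- ln C + - S t) / t%:R <= - c + e by near: t; exact: near_linear_lt.
rewrite -opprD mulNr => ? ?; rewrite ler_norml /=.
apply/andP; split; lra.
Unshelve. all: by end_near.
Qed.

Lemma cvg_rate_Ny (S : nat -> nat -> R) (c : nat -> R) (C : R) (y : nat -> R) :
  (forall j k, \forall t \near \oo, S j t < (c j + k.+1%:R^-1) * t.+1%:R) ->
  (forall A, exists j, c j <= A) ->
  0 < C -> (forall j t, y t <= C * expR (S j t)) ->
  (fun t : nat => ((t%:R^-1)%:E * lne (y t)%:E)%E) @ \oo --> -oo%E.
Proof.
move=> S_lt c_le C_gt0 y_le; apply/cvgeNyPle => A.
(* The spare 1 pays for the error term taken from [near_linear_lt]. *)
have [j cj_le] := c_le (A - 1).
near=> t.
have t_gt0 : 0 < t%:R :> R by rewrite ltr0n; near: t; exact: nbhs_infty_gt.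
have St_le : (ln C + S j t) / t%:R <= c j + 1.
  by near: t; exact: near_linear_lt.
(* A ratio that has hit 0 has [lne] equal to [-oo], below any level. *)
have [y_le0|y_gt0] := leP (y t) 0.
  by rewrite le0_lneNy ?lee_fin // gt0_muleNy ?lte_fin ?invr_gt0 // leNye.
rewrite lne_EFin // -EFinM lee_fin mulrC.
apply: (@le_trans _ _ ((ln C + S j t) / t%:R)); last by lra.
rewrite ler_pM2r ?invr_gt0 //.
rewrite -[S j t]expRK -lnM ?posrE ?expR_gt0 // ler_ln ?posrE //.
by rewrite mulr_gt0 ?expR_gt0.
Unshelve. all: by end_near.
Qed.
End Limits.

(** * Convergence of the beliefs *)

Unset Implicit Arguments.

Theorem mainTheorem2 (R : realType) (n : nat) (E : rel 'I_n)
    (Theta : finType) (nu : Theta -> R)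
    (Sig : 'I_n -> finType) (ell : forall i : 'I_n, Theta -> Sig i -> R)
    (P : 'M[R]_n) (pi : 'rV[R]_n)
    (d : measure_display) (T : measurableType d) (Pr : probability T R)
    (state : T -> Theta)
    (s : nat -> T -> {dffun forall i : 'I_n, Sig i})
    (sigma : nat -> T -> {ffun 'I_n -> 'I_n})
    (nu_pmf : is_pmf nu) (nu_gt0 : forall th, 0 < nu th)
    (ell_pmf : forall (i : 'I_n) (th : Theta), is_pmf (ell i th))
    (PE : gossip_matrix E P)
    (state_rv : finite_rv state) (state_law : has_law Pr state nu)
    (s_model : signal_model Pr ell state s)
    (sigma_model : gossip_model Pr P state s sigma)
    (th : Theta)
    (E_connected : strongly_connected E)
    (th_identifiable : forall th' : Theta, th' != th ->
      exists m : 'I_n, (0 < KL (ell m th) (ell m th'))%E)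
    (pi_stationary : stationary P pi) :
  let mu (w : T) (i : 'I_n) (t : nat) : Theta -> R :=
    belief nu ell (fun k => s k w) (fun k => sigma k w) t i in
  let rate (th' : Theta) : \bar R :=
    (- \sum_(m < n) (pi 0 m)%:E * KL (ell m th) (ell m th'))%E in
  (\forall w \ae cond_prob Pr (state @^-1` [set th]),
     forall (i : 'I_n) (th' : Theta), th' != th ->
       (fun t : nat =>
          ((t%:R^-1)%:E * lne ((mu w i t th' / mu w i t th)%:E))%E) @ \oo
       --> rate th')
  /\ (forall th' : Theta, th' != th -> (rate th' < 0)%E).
Proof.
move=> mu rate.
have pi_gt0 m : 0 < pi 0 m := stationary_gt0 E_connected PE m pi_stationary.
have ell_ge0 i th' u : 0 <= ell i th' u by case: (ell_pmf i th').
split; last first.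
  move=> th' th'N; rewrite /rate oppe_lt0.
  have [m KL_gt0] := th_identifiable th' th'N.
  rewrite (bigD1 m) //=; apply: lt_le_trans (leeDl _ _).
    by rewrite mule_gt0 ?lte_fin.
  apply: sume_ge0 => l _; rewrite mule_ge0 ?lee_fin ?(ltW (pi_gt0 l)) //.
  exact: KL_ge0.
have mC : measurable (state @^-1` [set th]) by exact: state_rv.
have mean_ae f := score_limsup_ae mC (state_law th) (nu_gt0 th) s_model
  sigma_model f E_connected PE pi_stationary (fun i => ell_pmf i th).
apply: (ae_cond_prob (mC := mC)).
suff : \forall w \ae mrestr Pr mC, forall th' i,
    (fun t : nat =>
          ((t%:R^-1)%:E * lne ((mu w i t th' / mu w i t th)%:E))%E) @ \oo
       --> rate th'.
  by apply: filterS => w Hw i th' _; exact: Hw.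
apply: filter_forall => th'.
pose f := truncated_llr ell th th'.
pose mean k := \sum_m pi 0 m * (\sum_x ell m th x * f k m x).
have C_gt0 : 0 < nu th' / nu th by rewrite divr_gt0.
have x_gt0_ae := signal_likelihood_gt0_ae mC (state_law th) (nu_gt0 th) s_model
  (fun i x => ell_ge0 i th x).
(* Either every agent has finite divergence, or some agent has a signal possible under [th] and
   impossible under [th']. *)
have [/forallP KL_finP|] := boolP [forall m, [forall u : Sig m,
    (ell m th u != 0) ==> (ell m th' u != 0)]].
  (* Truncation is inactive on signals possible under [th], and the others have weight 0, so level 0
     already gives the exact rate. *)
  have rateE : rate th' = (mean 0%N)%:E.
    rewrite /rate.
    under eq_bigr => m _.
      rewrite KL_fin // => [|u]; last first.
        by have /forallP/(_ u)/implyP := KL_finP m.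
      over.
    under eq_bigr do rewrite -EFinM.
    rewrite sumEFin -EFinN -sumrN; congr _%:E; apply: eq_bigr => m _.
    rewrite mulrN opprK; congr (_ * _); apply: eq_bigr => u _.
    rewrite /f /truncated_llr; case: eqP => // ellu.
    have [->|ellu'] := eqVneq (ell m th u) 0; first by rewrite !mul0r.
    by have /forallP/(_ u)/implyP/(_ ellu') := KL_finP m; rewrite ellu eqxx.
  have meanN : \sum_m pi 0 m * (\sum_x ell m th x * - f 0%N m x) = - mean 0%N.
    rewrite /mean -sumrN; apply: eq_bigr => m _; rewrite -mulrN -sumrN.
    by under eq_bigr do rewrite mulrN.
  have := mean_ae (f 0%N); have := mean_ae (fun m x => - f 0%N m x).
  rewrite meanN; move: x_gt0_ae.
  apply: filterS3 => w x_gt0 S_gt S_lt i; rewrite rateE.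
  apply: (cvg_rate_fin (S := score (f 0%N) (s^~ w) (sigma^~ w) ^~ i)) C_gt0 _.
  - by move=> k; exact: S_lt.
  - by move=> k; apply: filterS (S_gt k i) => t; rewrite scoreN.
  - move=> t; apply: belief_ratio_eq => // j u ellu.
    have /forallP/(_ u)/implyP := KL_finP j.
    rewrite gt_eqF // => /(_ isT) ellu'.
    rewrite /f /truncated_llr (negPf ellu') lnK // posrE divr_gt0 //.
    by rewrite lt_def ellu' ell_ge0.
rewrite negb_forall => /existsP[m]; rewrite negb_forall => /existsP[u].
rewrite negb_imply negbK => /andP[ellu /eqP ellu'].
have rateE : rate th' = -oo%E.
  rewrite /rate; apply/eqP; rewrite eqe_oppLR /=; apply/eqP.
  apply/esum_eqyP.
    move=> l _; rewrite gt_eqF // (@lt_le_trans _ _ 0%E) // mule_ge0 //.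
      by rewrite lee_fin ltW.
    exact: KL_ge0.
  exists m; split; rewrite ?mem_index_enum //.
  by rewrite (KL_eqy ellu ellu') gt0_muley ?lte_fin.
(* Truncation levels are countable, so one null set serves them all. *)
have : \forall w \ae mrestr Pr mC, forall j k i, \forall t \near \oo,
    score (f j) (s^~ w) (sigma^~ w) t i < (mean j + k.+1%:R^-1) * t.+1%:R.
  by apply: ae_foralln => j; exact: mean_ae.
move: x_gt0_ae; apply: filterS2 => w x_gt0 S_lt i; rewrite rateE.
apply: (cvg_rate_Ny
  (S := fun j => score (f j) (s^~ w) (sigma^~ w) ^~ i)) C_gt0 _.
- by move=> j k; exact: S_lt.
- move=> A.
  (* The stationary probability of a signal that rules out [th']: each unit of truncation depth
     lowers the mean by [b], so [b > 0] sends the means to minus infinity. *)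
  pose b := \sum_l pi 0 l *
    (\sum_v ell l th v * (ell l th' v == 0)%:R).
  have b_gt0 : 0 < b.
    have b_ge0 l : 0 <= \sum_v ell l th v * (ell l th' v == 0)%:R.
      by apply: sumr_ge0 => v _; rewrite mulr_ge0.
    rewrite /b (bigD1 m) //= ltr_pwDl //; last first.
      by apply: sumr_ge0 => l _; rewrite mulr_ge0 // ltW.
    rewrite mulr_gt0 // (bigD1 u) //= ltr_pwDl //.
      by rewrite ellu' eqxx mulr1 lt_def ellu ell_ge0.
    by apply: sumr_ge0 => v _; rewrite mulr_ge0.
  have meanE j : mean j = mean 0%N - j%:R * b.
    rewrite /mean /b mulr_sumr -sumrB; apply: eq_bigr => l _.
    rewrite mulrCA -mulrBr; congr (_ * _).
    rewrite mulr_sumr -sumrB; apply: eq_bigr => v _.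
    by rewrite mulrCA -mulrBr /f /truncated_llr; case: eqP => _; congr (_ * _);
      rewrite ?oppr0 ?mulr1 ?mulr0 ?sub0r ?subr0.
  exists (Num.truncn ((mean 0%N - A) / b)).+1; rewrite meanE.
  by rewrite lerBlDl -lerBlDr -ler_pdivrMr // ltW // truncnS_gt.
- move=> j t; apply: belief_ratio_le => // l v ellv.
  rewrite /f /truncated_llr; case: eqP => [->|/eqP ellv'].
    by rewrite mul0r expR_ge0.
  by rewrite lnK // posrE divr_gt0 // lt_def ellv' ell_ge0.
Qed.
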